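(* For every optimal prefix-free machine $V$, the real $\Theta_V=\sum_{s\in\{0,1\}^*,\,H_V(s)<|s|}2^{-|s|}$ is a left-computable real which is weakly Chaitin random.
   Context: $\{0,1\}^*$ is the set of finite binary strings; $|s|$ is the length of $s$. A prefix-free machine is a partial recursive function $C:\{0,1\}^*\to\{0,1\}^*$ whose domain is prefix-free. $H_C(s)=\min\{|p| : C(p)=s\}$ (possibly $\infty$). A prefix-free machine $U$ is optimal if for every prefix-free machine $C$ there is $d\in\mathbb{N}$ such that for every $p\in\mathrm{Dom}\,C$ there is $q\in\mathrm{Dom}\,U$ with $U(q)=C(p)$ and $|q|\le|p|+d$. A particular optimal prefix-free machine $U$ is fixed and $H(s):=H_U(s)$. For a real $\alpha$ and $n\ge1$, $\alpha\restriction n$ denotes the first $n$ bits of the base-two expansion of $\alpha-\lfloor\alpha\rfloor$ (the expansion with infinitely many zeros). A real $\alpha$ is right-computable if there is a total recursive $f:\mathbb{N}^+\to\mathbb{Q}$ with $\alpha\le f(n)$ for all $n$ and $f(n)\to\alpha$; $\alpha$ is left-computable if $-\alpha$ is right-computable. A real $\alpha$ is weakly Chaitin random if there is $c\in\mathbb{N}$ such that $n-c\le H(\alpha\restriction n)$ for all $n\in\mathbb{N}^+$. *)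

(* Defs.v *)
From Stdlib Require Import Reals Lra Lia ZArith QArith List Arith.
From Stdlib Require Import ClassicalDescription.
Import ListNotations.
Open Scope R_scope.

Inductive mu : Type :=
| MZero : mu
| MSucc : mu
| MProj : nat -> mu
| MComp : mu -> list mu -> mu
| MPrec : mu -> mu -> mu
| MMin  : mu -> mu.

Inductive eval : mu -> list nat -> nat -> Prop :=
| eZero : forall v, eval MZero v 0
| eSucc : forall x v, eval MSucc (x :: v) (S x)
| eProj : forall i v x, nth_error v i = Some x -> eval (MProj i) v x
| eComp : forall f gs v ys y,
    evals gs v ys -> eval f ys y -> eval (MComp f gs) v y
| ePrec0 : forall f g v y, eval f v y -> eval (MPrec f g) (0%nat :: v) y
| ePrecS : forall f g n v r y,
    eval (MPrec f g) (n :: v) r -> eval g (n :: r :: v) y ->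
    eval (MPrec f g) (S n :: v) y
| eMin : forall f v y,
    eval f (y :: v) 0%nat ->
    (forall z, (z < y)%nat -> exists k, eval f (z :: v) (S k)) ->
    eval (MMin f) v y
with evals : list mu -> list nat -> list nat -> Prop :=
| evNil : forall v, evals [] v []
| evCons : forall g gs v y ys,
    eval g v y -> evals gs v ys -> evals (g :: gs) v (y :: ys).

Definition bstring := list bool.

(* 0 <-> "", 1 <-> "0", 2 <-> "1", ... : k <-> binary of k+1 without leading 1 *)
Fixpoint bits_to_pos (s : bstring) : positive :=
  match s with
  | [] => xH
  | false :: s' => xO (bits_to_pos s')
  | true :: s' => xI (bits_to_pos s')
  end.

Fixpoint pos_to_bits (p : positive) : bstring :=
  match p with
  | xH => []
  | xO p' => false :: pos_to_bits p'
  | xI p' => true :: pos_to_bits p'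
  end.

Definition code_str (s : bstring) : nat := (Pos.to_nat (bits_to_pos s) - 1)%nat.
Definition decode_str (k : nat) : bstring := pos_to_bits (Pos.of_succ_nat k).

Definition machine := bstring -> option bstring.

Definition partial_recursive (C : machine) : Prop :=
  exists e : mu, forall p s, C p = Some s <-> eval e [code_str p] (code_str s).

Definition is_prefix (p q : bstring) : Prop := exists r, q = p ++ r.

Definition prefix_free_domain (C : machine) : Prop :=
  forall p q, C p <> None -> C q <> None -> is_prefix p q -> p = q.

Definition prefix_free_machine (C : machine) : Prop :=
  partial_recursive C /\ prefix_free_domain C.

Definition optimal (U : machine) : Prop :=
  prefix_free_machine U /\
  forall C : machine, prefix_free_machine C ->
    exists d : nat, forall p s, C p = Some s ->
      exists q, U q = Some s /\ (length q <= length p + d)%nat.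

Definition H_lt_length (C : machine) (s : bstring) : Prop :=
  exists p, C p = Some s /\ (length p < length s)%nat.

(* "n - c <= H_C(s)" (with H_C(s) = min of program lengths, possibly infinite):
   every C-program for s has length >= n - c. *)
Definition H_ge (C : machine) (s : bstring) (n c : nat) : Prop :=
  forall p, C p = Some s -> (n <= length p + c)%nat.

Definition Theta_term (V : machine) (k : nat) : R :=
  let s := decode_str k in
  if excluded_middle_informative (H_lt_length V s)
  then / 2 ^ length s else 0.

Definition frac_part (a : R) : R := a - IZR (Int_part a).

(* i-th bit (i >= 1) of the base-two expansion of a - floor a
   (the expansion with infinitely many zeros) *)
Definition bit (a : R) (i : nat) : bool :=
  Z.odd (Int_part (frac_part a * 2 ^ i)).

Definition restr (a : R) (n : nat) : bstring := map (bit a) (seq 1 n).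

Definition code_Z (z : Z) : nat :=
  if (0 <=? z)%Z then (2 * Z.to_nat z)%nat else (2 * Z.to_nat (- z) - 1)%nat.
Definition cpair (a b : nat) : nat := ((a + b) * (a + b + 1) / 2 + b)%nat.
Definition code_Q (q : Q) : nat :=
  cpair (code_Z (Qnum q)) (Pos.to_nat (Qden q) - 1).

Definition computable_Qseq (f : nat -> Q) : Prop :=
  exists e : mu, forall n, eval e [n] (code_Q (f n)).

(* f is indexed by N+ : only values at n >= 1 matter *)
Definition right_computable (a : R) : Prop :=
  exists f : nat -> Q, computable_Qseq f /\
    (forall n, (1 <= n)%nat -> a <= Q2R (f n)) /\
    Un_cv (fun n => Q2R (f (S n))) a.

Definition left_computable (a : R) : Prop := right_computable (- a).

Definition weakly_chaitin_random (U : machine) (a : R) : Prop :=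
  exists c : nat, forall n, (1 <= n)%nat -> H_ge U (restr a n) n c.

(* Main.v *)
(** Let [E m k] say that by stage [m] the enumeration of [V] has shown the string
    number [k] to be compressible.  The stage sums [S_m] of [2^-|s|] over the strings
    found compressible increase to [theta], and Kraft's inequality bounds [theta] by 1/2,
    since each such [s] has a program of length at most [|s| - 1].

    From the first [n] bits of [theta], of value [x/2^n], one can search for a stage [m]
    with [S_m >= (x - 1)/2^n]; the slack [1/2^n] guarantees that it exists even when
    [theta] is dyadic.  Then [theta - S_m < 2/2^n], so every compressible string of
    length [n - 1] has already been found, and by Kraft's inequality one of this length
    is left over.  Running this search on the output of [U] is a prefix-free machine,
    hence [n - 1 <= H_V(t) <= H_U(theta|n) + O(1)] for the leftover string [t]. *)

Require Import Defs.
From Stdlib Require Import Reals Lra Lia ZArith QArith Qreals List Arith FinFun.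
From Stdlib Require Import Classical ClassicalDescription.
Import ListNotations.
Local Open Scope nat_scope.

(** * Total computable functions of an environment *)

(* The environment [v] lists the [k] arguments; a binder pushes its variable in front,
   so variables are [hd 0 v], [hd 0 (tl v)], and so on. *)
Definition computable (k : nat) (F : list nat -> nat) : Prop :=
  exists e, forall v, length v = k -> eval e v (F v).

Definition computable_list (k m : nat) (L : list nat -> list nat) : Prop :=
  exists es, forall v, length v = k -> evals es v (L v) /\ length (L v) = m.

Definition computable_bool (k : nat) (P : list nat -> bool) : Prop :=
  computable k (fun v => Nat.b2n (P v)).

Lemma computable_ext k F G :
  (forall v, length v = k -> F v = G v) -> computable k F -> computable k G.
Proof.
  intros E [e He]. exists e. intros v Hv. rewrite <- E by assumption. auto.
Qed.

Lemma computable_subst k m F L :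
  computable m F -> computable_list k m L -> computable k (fun v => F (L v)).
Proof.
  intros [e He] [es Hes]. exists (MComp e es). intros v Hv.
  destruct (Hes v Hv) as [H1 H2]. econstructor; eauto.
Qed.

Lemma computable_list_nil k : computable_list k 0 (fun _ => []).
Proof. exists []. intros. split; constructor. Qed.

Lemma computable_list_cons k m G L :
  computable k G -> computable_list k m L ->
  computable_list k (S m) (fun v => G v :: L v).
Proof.
  intros [e He] [es Hes]. exists (e :: es). intros v Hv.
  destruct (Hes v Hv). split; [constructor|simpl]; auto.
Qed.

Lemma computable_S k F : computable k F -> computable k (fun v => S (F v)).
Proof.
  intros [e He]. exists (MComp MSucc [e]). intros v Hv.
  econstructor; [repeat constructor; auto | constructor].
Qed.

Lemma computable_const k c : computable k (fun _ => c).
Proof.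
  induction c as [|c IH]; [exists MZero; constructor | now apply computable_S].
Qed.

Lemma computable_var i k : i < k -> computable k (fun v => hd 0 (Nat.iter i (@tl nat) v)).
Proof.
  intros Hi. exists (MProj i). intros v Hv. constructor.
  assert (H : i < length v) by lia. clear Hi Hv. revert v H.
  induction i as [|i IH]; intros [|x v] H; simpl in *; try lia; auto.
  rewrite (IH v) by lia. f_equal. rewrite <- Nat.iter_swap. reflexivity.
Qed.

(** The list consists of projections, peeled off one variable at a time. With [i = 0] it is the
    identity environment; a larger [i] drops the variables that binders have pushed. *)
Lemma computable_list_tl m : forall i k,
  k = i + m -> computable_list k m (fun v => Nat.iter i (@tl nat) v).
Proof.
  induction m as [|m IH]; intros i k ->.
  - exists []. intros v Hv.
    assert (E : Nat.iter i (@tl nat) v = []).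
    { rewrite Nat.add_0_r in Hv. revert v Hv.
      induction i as [|i IH]; intros [|x v] Hv; simpl in *; try lia; auto.
      - rewrite <- Nat.iter_swap. apply (IH v). lia. }
    rewrite E. split; constructor.
  - destruct (IH (S i) (i + S m)) as [es Hes]; [lia|].
    destruct (computable_var i (i + S m)) as [e He]; [lia|].
    exists (e :: es). intros v Hv. specialize (Hes v Hv). specialize (He v Hv).
    simpl in Hes. destruct Hes as [H1 H2].
    assert (L : length (Nat.iter i (@tl nat) v) = S m).
    { clear - Hv. revert v Hv.
      induction i as [|i IH]; intros [|x v] Hv; simpl in *; try lia.
      rewrite <- Nat.iter_swap. apply (IH v). lia. }
    destruct (Nat.iter i (@tl nat) v) as [|x w]; [discriminate|].
    split; [now constructor | assumption].
Qed.

Lemma computable_tl k F : computable k F -> computable (S k) (fun w => F (tl w)).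
Proof.
  intros HF. apply (computable_subst (S k) k F (@tl nat) HF).
  now apply (computable_list_tl k 1).
Qed.

(** [MPrec] recurses on the first entry of its argument list; substituting [N v :: v] puts an
    arbitrary computed bound in that place. *)
Lemma computable_nat_rect k N A B :
  computable k N -> computable k A ->
  computable (S (S k)) (fun w => B (hd 0 w) (hd 0 (tl w)) (tl (tl w))) ->
  computable k (fun v => nat_rect (fun _ => nat) (A v) (fun n r => B n r v) (N v)).
Proof.
  intros HN [a Ha] [b Hb].
  apply (computable_subst k (S k)
    (fun w => nat_rect (fun _ => nat) (A (tl w)) (fun n r => B n r (tl w)) (hd 0 w))
    (fun v => N v :: v)).
  - exists (MPrec a b). intros [|n v] Hv; [discriminate|]. injection Hv as Hv. simpl.
    induction n as [|n IH]; [constructor; auto|].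
    simpl. econstructor; [exact IH|].
    apply (Hb (n :: _ :: v)). simpl. lia.
  - apply computable_list_cons; [assumption|]. now apply (computable_list_tl k 0).
Qed.

Lemma computable_subst_cons k m f L (Hf : computable (S m) (fun w => f (hd 0 w) (tl w))) T :
  computable k T -> computable_list k m L -> computable k (fun v => f (T v) (L v)).
Proof.
  intros HT HL.
  exact (computable_subst k (S m) _ _ Hf (computable_list_cons k m T L HT HL)).
Qed.

Lemma computable_1 k f A :
  computable 1 (fun v => f (hd 0 v)) -> computable k A -> computable k (fun v => f (A v)).
Proof.
  intros Hf HA.
  exact (computable_subst k 1 _ _ Hf
    (computable_list_cons k 0 A _ HA (computable_list_nil k))).
Qed.

Lemma computable_2 k f A B :
  computable 2 (fun v => f (hd 0 v) (hd 0 (tl v))) ->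
  computable k A -> computable k B -> computable k (fun v => f (A v) (B v)).
Proof.
  intros Hf HA HB.
  exact (computable_subst k 2 _ _ Hf (computable_list_cons k 1 A _ HA
    (computable_list_cons k 0 B _ HB (computable_list_nil k)))).
Qed.

(** * Arithmetic, case distinction, bounded search and bounded sums *)

Ltac computable_variable :=
  first [ apply (computable_var 0); lia | apply (computable_var 1); lia
        | apply (computable_var 2); lia | apply (computable_var 3); lia
        | apply (computable_var 4); lia | apply (computable_var 5); lia ].

Lemma computable_pred k A : computable k A -> computable k (fun v => Nat.pred (A v)).
Proof.
  apply computable_1.
  eapply computable_ext; [|apply (computable_nat_rect 1 (fun v => hd 0 v) (fun _ => 0)
    (fun n _ _ => n)); [computable_variable | apply computable_const | computable_variable]].
  intros v _. simpl. now destruct (hd 0 v).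
Qed.

Lemma computable_add k A B :
  computable k A -> computable k B -> computable k (fun v => A v + B v).
Proof.
  apply computable_2.
  eapply computable_ext; [|apply (computable_nat_rect 2 (fun v => hd 0 v)
    (fun v => hd 0 (tl v)) (fun _ r _ => S r));
    [computable_variable | computable_variable | apply computable_S; computable_variable]].
  intros v _. simpl. induction (hd 0 v); simpl; auto.
Qed.

Lemma computable_sub k A B :
  computable k A -> computable k B -> computable k (fun v => A v - B v).
Proof.
  apply computable_2.
  eapply computable_ext; [|apply (computable_nat_rect 2 (fun v => hd 0 (tl v))
    (fun v => hd 0 v) (fun _ r _ => Nat.pred r));
    [computable_variable | computable_variable | apply computable_pred; computable_variable]].
  intros v _. simpl. induction (hd 0 (tl v)); simpl; lia.
Qed.

Lemma computable_mul k A B :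
  computable k A -> computable k B -> computable k (fun v => A v * B v).
Proof.
  apply computable_2.
  eapply computable_ext; [|apply (computable_nat_rect 2 (fun v => hd 0 v)
    (fun v => 0) (fun _ r v => hd 0 (tl v) + r));
    [computable_variable | apply computable_const
    | apply computable_add; computable_variable]].
  intros v _. simpl. induction (hd 0 v); simpl; lia.
Qed.

Lemma computable_pow2 k A : computable k A -> computable k (fun v => 2 ^ A v).
Proof.
  apply computable_1.
  eapply computable_ext; [|apply (computable_nat_rect 1 (fun v => hd 0 v)
    (fun v => 1) (fun _ r _ => r + r));
    [computable_variable | apply computable_const
    | apply computable_add; computable_variable]].
  intros v _. simpl. induction (hd 0 v); simpl; lia.
Qed.

Lemma computable_ltb k A B :
  computable k A -> computable k B -> computable_bool k (fun v => A v <? B v).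
Proof.
  intros HA HB.
  (* With truncated subtraction, [1 - (1 - (b - a))] is 1 if [a < b] and 0 otherwise. *)
  eapply computable_ext; [|apply (computable_sub k (fun _ => 1)
    (fun v => 1 - (B v - A v))); [apply computable_const |
    apply computable_sub; [apply computable_const | now apply computable_sub]]].
  intros v _. cbv beta. destruct (Nat.ltb_spec (A v) (B v)); unfold Nat.b2n; lia.
Qed.

Lemma computable_andb k P Q :
  computable_bool k P -> computable_bool k Q -> computable_bool k (fun v => P v && Q v)%bool.
Proof.
  intros HP HQ. eapply computable_ext; [|exact (computable_mul k _ _ HP HQ)].
  intros v _. simpl. now destruct (P v), (Q v).
Qed.

Lemma computable_negb k P :
  computable_bool k P -> computable_bool k (fun v => negb (P v)).
Proof.
  intros HP. eapply computable_ext;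
    [|exact (computable_sub k _ _ (computable_const k 1) HP)].
  intros v _. simpl. now destruct (P v).
Qed.

(** Both branches are total, so the choice is the arithmetic combination [P * A + (1 - P) * B]. *)
Lemma computable_if k P A B :
  computable_bool k P -> computable k A -> computable k B ->
  computable k (fun v => if P v then A v else B v).
Proof.
  intros HP HA HB. eapply computable_ext; [|exact (computable_add k _ _
    (computable_mul k _ _ HP HA)
    (computable_mul k _ _ (computable_negb k P HP) HB))].
  intros v _. simpl. destruct (P v); simpl; lia.
Qed.

Lemma computable_eqb k A B :
  computable k A -> computable k B -> computable_bool k (fun v => A v =? B v).
Proof.
  intros HA HB. eapply computable_ext; [|exact (computable_andb k _ _
    (computable_negb k _ (computable_ltb k _ _ HA HB))
    (computable_negb k _ (computable_ltb k _ _ HB HA)))].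
  intros v _. cbv beta.
  destruct (Nat.ltb_spec (A v) (B v)), (Nat.ltb_spec (B v) (A v)),
    (Nat.eqb_spec (A v) (B v)); simpl; lia || reflexivity.
Qed.

(* The least [i < n] with [P i], and [n] if there is none. *)
Definition bounded_min (n : nat) (P : nat -> bool) : nat :=
  nat_rect (fun _ => nat) 0 (fun _ r => if P r then r else S r) n.

Lemma bounded_min_spec n P :
  let m := bounded_min n P in
  m <= n /\ (m < n -> P m = true) /\ forall i, i < m -> P i = false.
Proof.
  induction n as [|n IH]; [repeat split; simpl; lia|]. cbv zeta in *.
  change (bounded_min (S n) P)
    with (if P (bounded_min n P) then bounded_min n P else S (bounded_min n P)).
  set (m := bounded_min n P) in *. destruct IH as (H1 & H2 & H3).
  destruct (P m) eqn:E; [repeat split; auto|].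
  assert (m = n) as H by (destruct (Nat.eq_dec m n); [|discriminate H2; lia]; auto).
  repeat split; try lia.
  intros i Hi. destruct (Nat.eq_dec i m); [congruence | apply H3; lia].
Qed.

Lemma bounded_min_unique n P m :
  m <= n -> (m < n -> P m = true) -> (forall i, i < m -> P i = false) ->
  bounded_min n P = m.
Proof.
  intros H1 H2 H3. destruct (bounded_min_spec n P) as (G1 & G2 & G3).
  destruct (Nat.lt_trichotomy (bounded_min n P) m) as [H|[H|H]]; auto.
  - rewrite H3 in G2 by assumption. now specialize (G2 ltac:(lia)).
  - rewrite G3 in H2 by assumption. now specialize (H2 ltac:(lia)).
Qed.

Lemma computable_bounded_min k N P :
  computable k N -> computable_bool (S k) (fun w => P (hd 0 w) (tl w)) ->
  computable k (fun v => bounded_min (N v) (fun i => P i v)).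
Proof.
  intros HN HP.
  apply (computable_nat_rect k N (fun _ => 0) (fun _ r v => if P r v then r else S r));
    [assumption | apply computable_const |].
  apply computable_if; [|computable_variable|apply computable_S; computable_variable].
  apply (computable_subst_cons (S (S k)) k (fun x v => Nat.b2n (P x v)) (fun w => tl (tl w)) HP
    (fun w => hd 0 (tl w))); [computable_variable|].
  now apply (computable_list_tl k 2).
Qed.

Fixpoint sum_below (n : nat) (f : nat -> nat) : nat :=
  match n with 0 => 0 | S n => sum_below n f + f n end.

Lemma computable_sum_below k N f :
  computable k N -> computable (S k) (fun w => f (hd 0 w) (tl w)) ->
  computable k (fun v => sum_below (N v) (fun i => f i v)).
Proof.
  intros HN Hf.
  eapply computable_ext; [|apply (computable_nat_rect k N (fun _ => 0)
    (fun i r v => r + f i v)); [assumption | apply computable_const |]].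
  - intros v _. cbv beta. induction (N v) as [|n IH]; simpl; [|rewrite IH]; reflexivity.
  - apply computable_add; [computable_variable|].
    apply (computable_subst_cons (S (S k)) k f (fun w => tl (tl w)) Hf
      (fun w => hd 0 w)); [computable_variable|].
    now apply (computable_list_tl k 2).
Qed.

Definition exists_below (n : nat) (P : nat -> bool) : bool := existsb P (seq 0 n).

Lemma exists_below_true n P :
  exists_below n P = true <-> exists i, i < n /\ P i = true.
Proof.
  unfold exists_below. rewrite existsb_exists.
  split; intros [i [H1 H2]]; exists i; split; auto; [apply in_seq in H1 | apply in_seq]; lia.
Qed.

Lemma computable_exists_below k N P :
  computable k N -> computable_bool (S k) (fun w => P (hd 0 w) (tl w)) ->
  computable_bool k (fun v => exists_below (N v) (fun i => P i v)).
Proof.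
  intros HN HP.
  eapply computable_ext; [|apply (computable_ltb k
    (fun v => bounded_min (N v) (fun i => P i v)) N);
    [now apply computable_bounded_min | assumption]].
  intros v _. cbv beta. f_equal. apply Bool.eq_true_iff_eq.
  rewrite Nat.ltb_lt, exists_below_true.
  destruct (bounded_min_spec (N v) (fun i => P i v)) as (H1 & H2 & H3). split.
  - intros H. eauto.
  - intros [i [Hi HPi]].
    destruct (Nat.le_gt_cases (bounded_min (N v) (fun i => P i v)) i); [lia|].
    rewrite H3 in HPi by assumption. discriminate.
Qed.

(** The quotient is the least [q] with [A < (q + 1) * B]. As [B] is nonzero, it is at most [A],
    which bounds the search. *)
Lemma computable_div k A B :
  computable k A -> computable k B -> (forall v, B v <> 0) ->
  computable k (fun v => A v / B v).
Proof.
  intros HA HB H0.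
  eapply computable_ext; [|apply (computable_bounded_min k A
    (fun q v => A v <? S q * B v)); [assumption|]].
  - intros v _. cbv beta. specialize (H0 v).
    pose proof (Nat.div_mod_eq (A v) (B v)). pose proof (Nat.mod_upper_bound (A v) (B v) H0).
    apply bounded_min_unique.
    + apply Nat.Div0.div_le_upper_bound. nia.
    + intros _. apply Nat.ltb_lt. nia.
    + intros i Hi. apply Nat.ltb_ge. nia.
  - apply computable_ltb.
    + now apply computable_tl.
    + apply computable_mul; [apply computable_S; computable_variable|].
      now apply computable_tl.
Qed.

Lemma computable_log2_S k A : computable k A -> computable k (fun v => Nat.log2 (S (A v))).
Proof.
  apply (computable_1 k (fun x => Nat.log2 (S x))).
  eapply computable_ext; [|apply (computable_bounded_min 1 (fun v => hd 0 v)
    (fun i v => S (hd 0 v) <? 2 ^ S i)); [computable_variable|]].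
  - intros v _. cbv beta. generalize (hd 0 v). intros x.
    destruct (Nat.log2_spec (S x)) as [H1 H2]; [lia|].
    apply bounded_min_unique.
    + pose proof (Nat.log2_lt_lin (S x)). lia.
    + intros _. now apply Nat.ltb_lt.
    + intros i Hi. apply Nat.ltb_ge. etransitivity; [|exact H1].
      apply Nat.pow_le_mono_r; lia.
  - apply computable_ltb; [apply computable_S; computable_variable|].
    apply computable_pow2, computable_S. computable_variable.
Qed.

Lemma computable_odd k A : computable k A -> computable_bool k (fun v => Nat.odd (A v)).
Proof.
  intros HA. eapply computable_ext; [|apply (computable_negb k _ (computable_eqb k _ _ HA
    (computable_mul k _ _ (computable_const k 2) (computable_div k A (fun _ => 2) HA
    (computable_const k 2) ltac:(discriminate)))))].
  intros v _. cbv beta. f_equal.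
  pose proof (Nat.div2_odd (A v)) as H. rewrite Nat.div2_div in H.
  destruct (Nat.odd (A v)), (Nat.eqb_spec (A v) (2 * (A v / 2))); simpl in *; lia || reflexivity.
Qed.

(** * Stage-bounded evaluation *)

(** The generated induction principle gives no hypothesis for the list inside [MComp]; the inner
    induction on [gs] supplies it. *)
Lemma mu_nested_ind (P : mu -> Prop) :
  P MZero -> P MSucc -> (forall i, P (MProj i)) ->
  (forall f gs, P f -> Forall P gs -> P (MComp f gs)) ->
  (forall f g, P f -> P g -> P (MPrec f g)) ->
  (forall f, P f -> P (MMin f)) -> forall e, P e.
Proof.
  intros HZ HS HP HC HR HM. fix IH 1. intros [| |i|f gs|f g|f].
  - exact HZ.
  - exact HS.
  - apply HP.
  - apply HC; [apply IH|].
    induction gs as [|g gs IHgs]; constructor; [apply IH | exact IHgs].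
  - apply HR; apply IH.
  - apply HM, IH.
Qed.

(* [F t v] is [S y] when the evaluation of [e] on [v] ends with value [y]
   within budget [t], and [0] when the budget is exhausted first. *)
Definition approximates (k : nat) (e : mu) (F : nat -> list nat -> nat) : Prop :=
  computable (S k) (fun w => F (hd 0 w) (tl w)) /\
  (forall t t' v y, length v = k -> t <= t' -> F t v = S y -> F t' v = S y) /\
  (forall v y, length v = k -> (eval e v y <-> exists t, F t v = S y)).

(** A list of values has no spare value to signal failure, so success is a separate flag [b]. While
    [b] is false, [L] may hold junk, but it always has the right length. *)
Definition approximates_list (k : nat) (gs : list mu)
    (b : nat -> list nat -> bool) (L : nat -> list nat -> list nat) : Prop :=
  computable_bool (S k) (fun w => b (hd 0 w) (tl w)) /\
  computable_list (S k) (length gs) (fun w => L (hd 0 w) (tl w)) /\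
  (forall t t' v, length v = k -> t <= t' -> b t v = true ->
     b t' v = true /\ L t' v = L t v) /\
  (forall v ys, length v = k ->
     (evals gs v ys <-> exists t, b t v = true /\ L t v = ys)).

Lemma approximates_list_exists k gs :
  Forall (fun g => exists F, approximates k g F) gs ->
  exists b L, approximates_list k gs b L.
Proof.
  induction 1 as [|g gs (F & HF1 & HF2 & HF3) _ (b & L & HL1 & HL2 & HL3 & HL4)].
  - exists (fun _ _ => true), (fun _ _ => []). split; [|split; [|split]].
    + apply (computable_const _ 1).
    + apply computable_list_nil.
    + auto.
    + intros v ys _. split.
      * intros H. inversion H. now exists 0.
      * intros [_ [_ <-]]. constructor.
  - exists (fun t v => (0 <? F t v) && b t v)%bool, (fun t v => Nat.pred (F t v) :: L t v).
    split; [|split; [|split]].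
    + apply computable_andb; [|assumption].
      apply computable_ltb; [apply computable_const | assumption].
    + apply computable_list_cons; [|assumption].
      now apply computable_pred.
    + intros t t' v Hv Ht H. apply andb_prop in H as [H1 H2].
      destruct (HL3 t t' v Hv Ht H2) as [-> ->].
      destruct (F t v) eqn:E; [discriminate|]. now rewrite (HF2 t t' v _ Hv Ht E).
    + intros v ys Hv. split.
      * intros H. inversion H as [|? ? ? y ys' H1 H2]; subst; clear H.
        apply HF3 in H1 as [t1 H1]; [|reflexivity].
        apply HL4 in H2 as [t2 [H2 <-]]; [|reflexivity].
        exists (Nat.max t1 t2).
        rewrite (HF2 t1 _ v y eq_refl (Nat.le_max_l _ _) H1).
        destruct (HL3 t2 _ v eq_refl (Nat.le_max_r t1 t2) H2) as [-> ->].
        now split.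
      * intros [t [H <-]]. apply andb_prop in H as [H1 H2].
        constructor; [|apply HL4; eauto].
        apply HF3; [assumption|]. exists t. destruct (F t v); [discriminate | reflexivity].
Qed.

Lemma approximates_comp k f gs :
  (exists F, approximates (length gs) f F) ->
  Forall (fun g => exists F, approximates k g F) gs ->
  exists F, approximates k (MComp f gs) F.
Proof.
  intros (F & HF1 & HF2 & HF3) Hgs.
  destruct (approximates_list_exists k gs Hgs) as (b & L & HL1 & HL2 & HL3 & HL4).
  assert (HL : forall t v, length v = k -> length (L t v) = length gs).
  { intros t v Hv. destruct HL2 as [es Hes]. apply (Hes (t :: v)). simpl. lia. }
  exists (fun t v => if b t v then F t (L t v) else 0). split; [|split].
  - apply computable_if; [assumption | | apply computable_const].
    apply (computable_subst_cons (S k) (length gs) F (fun w => L (hd 0 w) (tl w)) HF1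
      (fun w => hd 0 w)); [computable_variable | assumption].
  - intros t t' v y Hv Ht H. destruct (b t v) eqn:E; [|discriminate].
    destruct (HL3 t t' v Hv Ht E) as [-> ->]. eauto.
  - intros v y Hv. split.
    + intros H. inversion H as [| | |? ? ? ys ? H1 H2| | |]; subst; clear H.
      apply HL4 in H1 as [t1 [H1 <-]]; [|reflexivity].
      apply HF3 in H2 as [t2 H2]; [|auto].
      exists (Nat.max t1 t2).
      destruct (HL3 t1 _ v eq_refl (Nat.le_max_l t1 t2) H1) as [-> ->].
      apply (HF2 t2); auto. lia.
    + intros [t H]. destruct (b t v) eqn:E; [|discriminate].
      econstructor; [apply HL4; eauto | apply HF3; eauto].
Qed.

(** One budget [t] serves every round, and an exhausted round makes all later ones return 0. *)
Fixpoint approximate_prec (F G : nat -> list nat -> nat) (t n : nat) (v : list nat) : nat :=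
  match n with
  | 0 => F t v
  | S n => let r := approximate_prec F G t n v in
           if 0 <? r then G t (n :: Nat.pred r :: v) else 0
  end.

Lemma approximates_prec k f g :
  (exists F, approximates k f F) -> (exists G, approximates (S (S k)) g G) ->
  exists F, approximates (S k) (MPrec f g) F.
Proof.
  intros (F & HF1 & HF2 & HF3) (G & HG1 & HG2 & HG3).
  set (R := approximate_prec F G).
  assert (RS : forall t n v, R t (S n) v =
    if 0 <? R t n v then G t (n :: Nat.pred (R t n v) :: v) else 0) by reflexivity.
  assert (mono : forall t t' n v y, length v = k -> t <= t' -> R t n v = S y -> R t' n v = S y).
  { intros t t' n v y Hv Ht. revert y.
    induction n as [|n IH]; [intros y; apply HF2; assumption|].
    intros y H. rewrite RS in H |- *.
    destruct (R t n v) as [|r]; [discriminate|]. rewrite (IH r eq_refl). simpl in *.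
    apply (HG2 t); [simpl; lia | assumption | assumption]. }
  exists (fun t w => R t (hd 0 w) (tl w)). split; [|split].
  - eapply computable_ext; [|apply (computable_nat_rect (S (S k)) (fun w => hd 0 (tl w))
      (fun w => F (hd 0 w) (tl (tl w)))
      (fun n r w => if 0 <? r then G (hd 0 w) (n :: Nat.pred r :: tl (tl w)) else 0))].
    + intros v _. cbv beta. induction (hd 0 (tl v)) as [|n IH]; simpl; [|rewrite IH]; reflexivity.
    + computable_variable.
    + apply (computable_subst_cons (S (S k)) k F (fun w => tl (tl w)) HF1 (fun w => hd 0 w));
        [computable_variable | now apply (computable_list_tl k 2)].
    + apply computable_if; [| |apply computable_const].
      * apply computable_ltb; [apply computable_const | computable_variable].
      * apply (computable_subst_cons (S (S (S (S k)))) (S (S k)) G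
          (fun w => hd 0 w :: Nat.pred (hd 0 (tl w)) :: tl (tl (tl (tl w)))) HG1
          (fun w => hd 0 (tl (tl w)))); [computable_variable|].
        apply computable_list_cons; [computable_variable|].
        apply computable_list_cons; [apply computable_pred; computable_variable|].
        now apply (computable_list_tl k 4).
  - intros t t' [|n v] y Hv; [discriminate|]. injection Hv as Hv. simpl. now apply mono.
  - intros [|n v] y Hv; [discriminate|]. injection Hv as Hv. simpl.
    revert y. induction n as [|n IH]; intros y.
    + split.
      * intros H. inversion H. subst. now apply HF3.
      * intros H. constructor. now apply HF3.
    + split.
      * intros H. inversion H as [| | | | |? ? ? ? r ? H1 H2|]; subst; clear H.
        apply IH in H1 as [t1 H1].
        apply HG3 in H2 as [t2 H2]; [|reflexivity].
        exists (Nat.max t1 t2). rewrite RS.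
        rewrite (mono t1 _ n v r eq_refl (Nat.le_max_l _ _) H1). simpl.
        apply (HG2 t2); auto. lia.
      * intros [t H]. rewrite RS in H.
        destruct (R t n v) as [|r] eqn:E; [discriminate|]. simpl in H.
        econstructor; [apply IH; eauto|]. apply HG3; [simpl; lia | eauto].
Qed.

(** The budget bounds both the range of the search and each evaluation inside it. *)
Lemma approximates_min k f :
  (exists F, approximates (S k) f F) -> exists F, approximates k (MMin f) F.
Proof.
  intros (F & HF1 & HF2 & HF3).
  (* A value of [F] that is at least 2 reports a positive value of [f]. The search therefore stops
     at a zero of [f], reported as 1, or at an exhausted evaluation, reported as 0; only the first
     counts as success in [R]. *)
  set (m := fun t v => bounded_min t (fun i => F t (i :: v) <? 2)).
  assert (m_spec : forall t v, m t v <= t /\ forall i, i < m t v -> 2 <= F t (i :: v)).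
  { intros t v. destruct (bounded_min_spec t (fun i => F t (i :: v) <? 2)) as (H1 & _ & H2).
    split; [exact H1|]. intros i Hi. now apply Nat.ltb_ge, H2. }
  set (R := fun t v => if F t (m t v :: v) =? 1 then S (m t v) else 0).
  assert (spec : forall t v y, R t v = S y <->
    m t v = y /\ F t (y :: v) = 1 /\ forall i, i < y -> 2 <= F t (i :: v)).
  { intros t v y. unfold R. destruct (m_spec t v) as [_ H].
    destruct (Nat.eqb_spec (F t (m t v :: v)) 1) as [E|E]; split.
    - intros [= <-]. auto.
    - now intros [<- _].
    - discriminate.
    - intros [<- [? _]]. contradiction. }
  assert (intro : forall t v y, y <= t -> F t (y :: v) = 1 ->
    (forall i, i < y -> 2 <= F t (i :: v)) -> R t v = S y).
  { intros t v y Hy H1 H2. apply spec. repeat split; auto.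
    apply bounded_min_unique; [assumption| |].
    - intros _. now rewrite H1.
    - intros i Hi. now apply Nat.ltb_ge, H2. }
  assert (mono : forall t t' w y, length w = S k -> t <= t' -> y <= F t w -> 0 < y -> y <= F t' w).
  { intros t t' w y Hw Ht H Hy. destruct (F t w) as [|z] eqn:E; [lia|].
    now rewrite (HF2 t t' w z). }
  exists R. split; [|split].
  - assert (Hm : computable (S k) (fun w => m (hd 0 w) (tl w))).
    { apply (computable_bounded_min (S k) (fun w => hd 0 w)
        (fun i w => F (hd 0 w) (i :: tl w) <? 2)); [computable_variable|].
      apply computable_ltb; [|apply computable_const].
      apply (computable_subst_cons (S (S k)) (S k) F (fun w => hd 0 w :: tl (tl w)) HF1
        (fun w => hd 0 (tl w))); [computable_variable|].
      apply computable_list_cons; [computable_variable | now apply (computable_list_tl k 2)]. }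
    apply computable_if; [|now apply computable_S | apply computable_const].
    apply computable_eqb; [|apply computable_const].
    apply (computable_subst_cons (S k) (S k) F (fun w => m (hd 0 w) (tl w) :: tl w) HF1
      (fun w => hd 0 w)); [computable_variable|].
    apply computable_list_cons; [assumption | now apply (computable_list_tl k 1)].
  - intros t t' v y Hv Ht H. apply spec in H as (Hm & H1 & H2).
    apply intro.
    + destruct (m_spec t v). lia.
    + apply (HF2 t); simpl; auto.
    + intros i Hi. apply (mono t); simpl; auto.
  - intros v y Hv. split.
    + intros H. inversion H as [| | | | | |? ? ? H1 H2]; subst; clear H.
      apply HF3 in H1 as [t1 H1]; [|reflexivity].
      (* Only finitely many [i < y] are involved, so one budget suffices for all of them. *)
      assert (exists t2, forall i, i < y -> 2 <= F t2 (i :: v)) as [t2 Ht2].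
      { clear H1. induction y as [|y IH]; [exists 0; lia|].
        destruct IH as [t2 Ht2]; [auto with arith|].
        destruct (H2 y) as [z Hz]; [lia|].
        apply HF3 in Hz as [t3 Hz]; [|reflexivity].
        exists (Nat.max t2 t3). intros i Hi.
        destruct (Nat.eq_dec i y) as [->|Hne].
        - apply (mono t3); simpl; lia.
        - apply (mono t2); simpl; try lia. apply Ht2. lia. }
      exists (Nat.max y (Nat.max t1 t2)). apply intro; [lia| |].
      * apply (HF2 t1); simpl; lia.
      * intros i Hi. apply (mono t2); simpl; try lia. now apply Ht2.
    + intros [t H]. apply spec in H as (_ & H1 & H2). constructor.
      * apply HF3; simpl; eauto.
      * intros z Hz. apply H2 in Hz.
        exists (F t (z :: v) - 2). apply HF3; [simpl; auto|]. exists t. lia.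
Qed.

(** A form of Kleene's normal form theorem. A separate approximation is built for each fixed program
    by induction on [e], so programs are never coded as numbers. *)
Theorem approximates_exists e : forall k, exists F, approximates k e F.
Proof.
  induction e as [| |i|f gs IHf IHgs|f g IHf IHg|f IHf] using mu_nested_ind; intros k.
  - exists (fun _ _ => 1). split; [apply computable_const|split; [auto|]].
    intros v y _. split.
    + intros H. inversion H. now exists 0.
    + intros [_ [= <-]]. constructor.
  - destruct k as [|k].
    (* No rule evaluates [MSucc] on an empty list, so the approximation never succeeds. The other
       unsuitable arities below are treated alike. *)
    + exists (fun _ _ => 0). split; [apply computable_const|split; [auto|]].
      intros [|x v] y Hv; [|discriminate]. split; [intros H; inversion H | intros [_ [=]]].
    + exists (fun _ v => S (S (hd 0 v))).
      split; [do 2 apply computable_S; computable_variable|split; [auto|]].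
      intros [|x v] y Hv; [discriminate|]. split.
      * intros H. inversion H. now exists 0.
      * intros [_ [= <-]]. constructor.
  - destruct (Nat.lt_ge_cases i k) as [Hi|Hi].
    + exists (fun _ v => S (nth i v 0)). split; [|split; [auto|]].
      * apply computable_S.
        apply (computable_tl k (fun v => nth i v 0)).
        eapply computable_ext; [|apply (computable_var i k Hi)].
        intros v _. cbv beta. revert v. clear. induction i as [|i IH]; [now intros [|x v]|].
        intros v. change (hd 0 (tl (Nat.iter i (@tl nat) v)) = nth (S i) v 0).
        rewrite <- Nat.iter_swap, IH. destruct v; [now destruct i | reflexivity].
      * intros v y Hv. split.
        -- intros H. inversion H. exists 0. f_equal. now apply nth_error_nth.
        -- intros [_ [= <-]]. constructor. apply nth_error_nth'. lia.
    + exists (fun _ _ => 0). split; [apply computable_const|split; [auto|]].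
      intros v y Hv. split; [|intros [_ [=]]].
      intros H. inversion H as [| |? ? ? E| | | |].
      rewrite <- Hv in Hi. apply nth_error_None in Hi. congruence.
  - apply approximates_comp; [auto|].
    induction IHgs; constructor; auto.
  - destruct k as [|k]; [|now apply approximates_prec].
    exists (fun _ _ => 0). split; [apply computable_const|split; [auto|]].
    intros [|x v] y Hv; [|discriminate]. split; [intros H; inversion H | intros [_ [=]]].
  - now apply approximates_min.
Qed.

(** By monotonicity both results show up at a common budget, where the function [F] has a single
    value. *)
Corollary eval_deterministic e v y z : eval e v y -> eval e v z -> y = z.
Proof.
  destruct (approximates_exists e (length v)) as (F & _ & mono & HF).
  intros [t1 H1]%HF [t2 H2]%HF; try reflexivity.
  apply (mono _ (Nat.max t1 t2)) in H1, H2; try lia.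
Qed.

(** * Strings, codes and searches *)

(** In binary, [k + 1] is the string number [k] with a 1 in the leading place, so this is the length
    of that string. *)
Definition len (k : nat) : nat := Nat.log2 (S k).

Lemma bits_to_pos_to_bits p : bits_to_pos (pos_to_bits p) = p.
Proof. induction p as [p IH|p IH|]; simpl; rewrite ?IH; reflexivity. Qed.

Lemma pos_to_bits_to_pos s : pos_to_bits (bits_to_pos s) = s.
Proof. induction s as [|[|] s IH]; simpl; rewrite ?IH; reflexivity. Qed.

Lemma S_code_str s : S (code_str s) = Pos.to_nat (bits_to_pos s).
Proof. unfold code_str. pose proof (Pos2Nat.is_pos (bits_to_pos s)). lia. Qed.

Lemma code_decode k : code_str (decode_str k) = k.
Proof. unfold code_str, decode_str. rewrite bits_to_pos_to_bits, SuccNat2Pos.id_succ. lia. Qed.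

Lemma decode_code s : decode_str (code_str s) = s.
Proof.
  unfold decode_str. rewrite <- (pos_to_bits_to_pos s) at 2. f_equal.
  apply Pos2Nat.inj. now rewrite SuccNat2Pos.id_succ, S_code_str.
Qed.

Lemma len_code_str s : len (code_str s) = length s.
Proof.
  unfold len. rewrite S_code_str.
  induction s as [|[|] s IH]; simpl; [reflexivity| |];
    pose proof (Pos2Nat.is_pos (bits_to_pos s)).
  - rewrite Pos2Nat.inj_xI, <- IH, <- Nat.log2_succ_double by lia. f_equal. lia.
  - rewrite Pos2Nat.inj_xO, <- IH, <- Nat.log2_double by lia. reflexivity.
Qed.

Lemma length_decode_str k : length (decode_str k) = len k.
Proof. now rewrite <- len_code_str, code_decode. Qed.

Lemma len_le k : len k <= k.
Proof. unfold len. pose proof (Nat.log2_lt_lin (S k)). lia. Qed.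

(** Halting is decided classically, and the output is picked by definite description, which is
    legitimate because [eval] is deterministic. *)
Lemma machine_of_mu e :
  exists C : machine, forall p s, C p = Some s <-> eval e [code_str p] (code_str s).
Proof.
  assert (H : forall p, { r : option bstring |
    forall s, r = Some s <-> eval e [code_str p] (code_str s) }).
  { intros p.
    destruct (excluded_middle_informative (exists y, eval e [code_str p] y)) as [Hy|Hy].
    - destruct (constructive_definite_description (eval e [code_str p])) as [y Hy'].
      { destruct Hy as [y Hy]. exists y. split; [assumption|].
        intros z Hz. now apply (eval_deterministic e [code_str p]). }
      exists (Some (decode_str y)). intros s. split.
      + intros [= <-]. now rewrite code_decode.
      + intros Hs. now rewrite (eval_deterministic _ _ _ _ Hy' Hs), decode_code.
    - exists None. intros s. split; [discriminate|]. intros Hs. elim Hy. eauto. }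
  exists (fun p => proj1_sig (H p)). intros p s. apply (proj2_sig (H p)).
Qed.

(** The known zero [y0] only guarantees that the search halts; the zero found may be smaller. *)
Lemma minimization k F :
  computable (S k) (fun w => F (hd 0 w) (tl w)) ->
  exists e, forall v y0, length v = k -> F y0 v = 0 -> exists y, F y v = 0 /\ eval e v y.
Proof.
  intros [e He]. exists (MMin e). intros v y0 Hv H0.
  destruct (bounded_min_spec y0 (fun i => F i v =? 0)) as (H1 & H2 & H3).
  set (y := bounded_min y0 (fun i => F i v =? 0)) in *.
  assert (Hy : F y v = 0).
  { destruct (Nat.eq_dec y y0) as [->|Hne]; [assumption|]. apply Nat.eqb_eq, H2. lia. }
  exists y. split; [assumption|]. constructor.
  - rewrite <- Hy. apply (He (y :: v)). simpl. lia.
  - intros z Hz. exists (Nat.pred (F z v)). apply H3, Nat.eqb_neq in Hz.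
    replace (S (Nat.pred (F z v))) with (F z v) by lia.
    apply (He (z :: v)). simpl. lia.
Qed.

(* [E m k] is decidable, and means that the string number [k] is found by stage [m]
   to have a program shorter than itself. *)
Definition enumerates (V : machine) (E : nat -> nat -> bool) : Prop :=
  computable_bool 2 (fun v => E (hd 0 v) (hd 0 (tl v))) /\
  (forall m m' k, m <= m' -> E m k = true -> E m' k = true) /\
  (forall m k, E m k = true -> k < m) /\
  (forall k, H_lt_length V (decode_str k) <-> exists m, E m k = true).

Lemma enumerates_exists V : partial_recursive V -> exists E, enumerates V E.
Proof.
  intros [e He].
  destruct (approximates_exists e 1) as (F & HF & mono & HFe).
  (* The stage [m] bounds the string number, the program number and the evaluation budget at once.
     This makes the test decidable and monotone in [m], and leaves finitely many strings at each
     stage. *)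
  exists (fun m k => (k <? m) &&
    exists_below m (fun p => (F m [p] =? S k) && (len p <? len k)))%bool.
  assert (spec : forall m k, ((k <? m) &&
    exists_below m (fun p => (F m [p] =? S k) && (len p <? len k)))%bool = true <->
    k < m /\ exists p, p < m /\ F m [p] = S k /\ len p < len k).
  { intros m k. rewrite Bool.andb_true_iff, Nat.ltb_lt, exists_below_true.
    setoid_rewrite Bool.andb_true_iff. setoid_rewrite Nat.eqb_eq.
    setoid_rewrite Nat.ltb_lt. reflexivity. }
  split; [|split; [|split]].
  - apply computable_andb; [apply computable_ltb; computable_variable|].
    apply (computable_exists_below 2 (fun v => hd 0 v) (fun p v =>
      (F (hd 0 v) [p] =? S (hd 0 (tl v))) && (len p <? len (hd 0 (tl v))))%bool);
      [computable_variable|].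
    apply computable_andb.
    + apply computable_eqb; [|apply computable_S; computable_variable].
      apply (computable_subst_cons 3 1 F (fun w => [hd 0 w]) HF (fun w => hd 0 (tl w)));
        [computable_variable|].
      apply computable_list_cons; [computable_variable | apply computable_list_nil].
    + apply computable_ltb; apply computable_log2_S; computable_variable.
  - intros m m' k Hm. rewrite !spec. intros (H1 & p & H2 & H3 & H4). split; [lia|].
    exists p. repeat split; [lia| |assumption]. now apply (mono m).
  - intros m k. rewrite spec. tauto.
  - intros k. split.
    + intros (p & Hp & Hlt). apply He in Hp. rewrite code_decode in Hp.
      apply HFe in Hp as [t Ht]; [|reflexivity].
      exists (S (Nat.max t (Nat.max k (code_str p)))). apply spec. split; [lia|].
      exists (code_str p). repeat split; [lia| |].
      * apply (mono t); [reflexivity | lia | assumption].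
      * rewrite len_code_str. now rewrite <- length_decode_str.
    + intros [m Hm]. apply spec in Hm as (_ & p & _ & Hp & Hlt).
      exists (decode_str p). rewrite !length_decode_str. split; [|assumption].
      apply He. rewrite !code_decode. apply HFe; eauto.
Qed.

(* [2 ^ m] times the stage sum; [m - len k] is not truncated as [len k <= k < m]. *)
Definition stage_numerator (E : nat -> nat -> bool) (m : nat) : nat :=
  sum_below m (fun k => if E m k then 2 ^ (m - len k) else 0).

Lemma computable_stage_numerator V E k A :
  enumerates V E -> computable k A -> computable k (fun v => stage_numerator E (A v)).
Proof.
  intros [HE _].
  apply (computable_1 k (stage_numerator E)).
  apply (computable_sum_below 1 (fun v => hd 0 v) (fun k v =>
    if E (hd 0 v) k then 2 ^ (hd 0 v - len k) else 0)); [computable_variable|].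
  apply computable_if; [| |apply computable_const].
  - apply (computable_2 2 (fun m k => Nat.b2n (E m k)) _ _ HE); computable_variable.
  - apply computable_pow2, computable_sub; [computable_variable|].
    apply computable_log2_S. computable_variable.
Qed.

(* The number whose binary digits, most significant first, form the string. *)
Fixpoint binary_value (s : bstring) : nat :=
  match s with [] => 0 | b :: s => Nat.b2n b * 2 ^ length s + binary_value s end.

Lemma binary_value_snoc s b : binary_value (s ++ [b]) = 2 * binary_value s + Nat.b2n b.
Proof.
  induction s as [|a s IH]; simpl; [lia|].
  rewrite IH, length_app, Nat.add_comm with (n := length s). simpl. lia.
Qed.

(* [code_str] puts the first bit of a string in the least significant place. *)
Definition coded_value (x : nat) : nat :=
  sum_below (len x) (fun i => if Nat.odd (S x / 2 ^ i) then 2 ^ (len x - 1 - i) else 0).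

Lemma sum_below_ext n f g : (forall i, i < n -> f i = g i) -> sum_below n f = sum_below n g.
Proof.
  intros H. induction n as [|n IH]; simpl; [reflexivity|].
  rewrite IH, H by auto. reflexivity.
Qed.

Lemma sum_below_shift n f : sum_below (S n) f = f 0 + sum_below n (fun i => f (S i)).
Proof. induction n as [|n IH]; simpl in *; lia. Qed.

(** Place 0 of [code_str s + 1] holds the first bit, and halving removes it, whence the induction.
    The leading 1 is in place [length s], just outside the sum. *)
Lemma coded_value_code_str s : coded_value (code_str s) = binary_value s.
Proof.
  unfold coded_value. rewrite len_code_str, S_code_str.
  induction s as [|b s IH]; [reflexivity|]. cbn [length binary_value].
  rewrite <- IH, sum_below_shift. f_equal.
  - rewrite Nat.pow_0_r, Nat.div_1_r.
    replace (S (length s) - 1 - 0) with (length s) by lia.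
    destruct b; cbn [bits_to_pos].
    + rewrite Pos2Nat.inj_xI, Nat.odd_succ, Nat.even_mul. simpl. lia.
    + rewrite Pos2Nat.inj_xO, Nat.odd_mul. reflexivity.
  - apply sum_below_ext. intros i Hi.
    replace (S (length s) - 1 - S i) with (length s - 1 - i) by lia.
    replace (Pos.to_nat (bits_to_pos (b :: s)) / 2 ^ S i)
      with (Pos.to_nat (bits_to_pos s) / 2 ^ i); [reflexivity|].
    rewrite Nat.pow_succ_r', <- Nat.Div0.div_div. f_equal.
    destruct b; cbn [bits_to_pos].
    + rewrite Pos2Nat.inj_xI.
      rewrite <- Nat.add_1_r, Nat.mul_comm, Nat.div_add_l by lia. simpl. lia.
    + rewrite Pos2Nat.inj_xO, Nat.mul_comm, Nat.div_mul by lia. reflexivity.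
Qed.

Lemma computable_coded_value k A : computable k A -> computable k (fun v => coded_value (A v)).
Proof.
  apply (computable_1 k coded_value).
  apply (computable_sum_below 1 (fun v => len (hd 0 v)) (fun i v =>
    if Nat.odd (S (hd 0 v) / 2 ^ i) then 2 ^ (len (hd 0 v) - 1 - i) else 0));
    [apply computable_log2_S; computable_variable|].
  apply computable_if; [| |apply computable_const].
  - apply computable_odd, computable_div.
    + apply computable_S. computable_variable.
    + apply computable_pow2. computable_variable.
    + intros v. now apply Nat.pow_nonzero.
  - apply computable_pow2, computable_sub; [|computable_variable].
    apply computable_sub; [|apply computable_const].
    apply computable_log2_S. computable_variable.
Qed.

(** The algorithm that turns the first bits of theta into an incompressible string. The inequality
    says that the stage sum is at least [(coded_value x - 1) / 2 ^ len x], multiplied out so as to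
    stay within the natural numbers. The two hypotheses on [x] make the two successive searches
    halt. *)
Lemma incompressible_search V E :
  enumerates V E -> exists e, forall x m0,
    coded_value x * 2 ^ m0 <= stage_numerator E m0 * 2 ^ len x + 2 ^ m0 ->
    (forall m, exists k, S (len k) = len x /\ E m k = false) ->
    exists m k, eval e [x] k /\
      coded_value x * 2 ^ m <= stage_numerator E m * 2 ^ len x + 2 ^ m /\
      S (len k) = len x /\ E m k = false.
Proof.
  intros HE.
  destruct (minimization 1 (fun m v => Nat.b2n
    (stage_numerator E m * 2 ^ len (hd 0 v) + 2 ^ m <? coded_value (hd 0 v) * 2 ^ m)))
    as [e1 He1].
  { apply computable_ltb; [apply computable_add|]; try apply computable_mul;
      try apply (computable_stage_numerator V); try apply computable_pow2;
      try apply computable_coded_value; try apply computable_log2_S;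
      assumption || computable_variable. }
  destruct (minimization 2 (fun k v => Nat.b2n
    (negb ((S (len k) =? len (hd 0 (tl v))) && negb (E (hd 0 v) k)))))
    as [e2 He2].
  { apply computable_negb, computable_andb.
    - apply computable_eqb; [apply computable_S|]; apply computable_log2_S; computable_variable.
    - apply computable_negb.
      apply (computable_2 3 (fun m k => Nat.b2n (E m k)) _ _ (proj1 HE)); computable_variable. }
  (* [e1] finds the stage; [e2] receives this stage together with the input and finds the string. *)
  exists (MComp e2 [e1; MProj 0]). intros x m0 Hm0 Hk.
  destruct (He1 [x] m0 eq_refl) as (m & Hm & H1).
  { cbn [hd]. destruct (Nat.ltb_spec (stage_numerator E m0 * 2 ^ len x + 2 ^ m0)
      (coded_value x * 2 ^ m0)); [lia | reflexivity]. }
  destruct (Hk m) as (k0 & Hk0 & HE0).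
  destruct (He2 [m; x] k0 eq_refl) as (k & Hk' & H2).
  { cbn [hd tl]. now rewrite Hk0, HE0, Nat.eqb_refl. }
  exists m, k. cbn [hd tl] in Hm, Hk'. split; [|split].
  - econstructor; [|exact H2]. repeat constructor. exact H1.
  - destruct (Nat.ltb_spec (stage_numerator E m * 2 ^ len x + 2 ^ m)
      (coded_value x * 2 ^ m)); [discriminate | assumption].
  - destruct (Nat.eqb_spec (S (len k)) (len x)), (E m k); try discriminate. auto.
Qed.

Local Open Scope R_scope.

(** * Kraft's inequality *)

Fixpoint measure (l : list bstring) : R :=
  match l with [] => 0 | s :: l => / 2 ^ length s + measure l end.

Lemma inv_pow2_pos n : 0 < / 2 ^ n.
Proof. apply Rinv_0_lt_compat, pow_lt. lra. Qed.

Lemma inv_pow2_S n : / 2 ^ S n = / 2 ^ n / 2.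
Proof. simpl. rewrite Rinv_mult. lra. Qed.

(** Repetitions are excluded because [measure] would count them several times. *)
Definition prefix_free_list (l : list bstring) : Prop :=
  NoDup l /\ forall p q, In p l -> In q l -> is_prefix p q -> p = q.

Fixpoint tails (b : bool) (l : list bstring) : list bstring :=
  match l with
  | (a :: s) :: l => if Bool.eqb a b then s :: tails b l else tails b l
  | _ :: l => tails b l
  | [] => []
  end.

Lemma in_tails b l s : In s (tails b l) <-> In (b :: s) l.
Proof.
  induction l as [|[|a t] l IH]; simpl; [tauto| |].
  - rewrite IH. split; [auto | intros [H|H]; [discriminate | assumption]].
  - destruct (Bool.eqb_spec a b) as [->|Hne]; simpl; rewrite IH.
    + split; (intros [H|H]; [left; congruence | auto]).
    + split; [auto | intros [H|H]; [congruence | assumption]].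
Qed.

Lemma prefix_free_tails b l : prefix_free_list l -> prefix_free_list (tails b l).
Proof.
  intros [H1 H2]. split.
  - clear H2. induction H1 as [|[|a s] l Hs _ IH]; simpl; [constructor|assumption|].
    destruct (Bool.eqb_spec a b) as [->|Hne]; [|assumption].
    constructor; [now rewrite in_tails | assumption].
  - intros p q Hp%in_tails Hq%in_tails [r Hr].
    assert (E : b :: p = b :: q) by (apply H2; auto; exists r; simpl; congruence).
    congruence.
Qed.

Lemma measure_tails l :
  ~ In [] l -> measure l = (measure (tails false l) + measure (tails true l)) / 2.
Proof.
  induction l as [|[|a s] l IH]; cbn [measure tails]; intros H.
  - lra.
  - elim H. now left.
  - rewrite IH by (intros H'; apply H; now right).
    destruct a; cbn [Bool.eqb measure length]; rewrite inv_pow2_S; lra.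
Qed.

(** Induction on a bound for the lengths: sorting by the first bit and removing it gives two
    prefix-free lists of shorter strings, and [measure l] is the mean of their measures. *)
Theorem kraft l : prefix_free_list l -> measure l <= 1.
Proof.
  assert (H : exists L, forall s, In s l -> (length s <= L)%nat).
  { induction l as [|s l [L IH]]; [now exists 0%nat|].
    exists (Nat.max (length s) L). intros t [<-|Ht%IH]; lia. }
  destruct H as [L HL]. revert l HL.
  (* The empty string is a prefix of every string, so it must be the only member. *)
  assert (base : forall l, prefix_free_list l -> In [] l -> measure l <= 1).
  { intros l [H1 H2] H0. destruct l as [|s [|t l]].
    - destruct H0.
    - destruct H0 as [->|[]]. simpl. lra.
    - exfalso. inversion H1 as [|? ? H3]. apply H3. left.
      transitivity (@nil bool); [symmetry|]; apply H2; auto; try (simpl; tauto).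
      + now exists t.
      + now exists s. }
  induction L as [|L IH]; intros l HL Hl.
  - destruct l as [|s l]; [simpl; lra|]. apply base; [assumption|].
    specialize (HL s (or_introl eq_refl)). destruct s; [now left | simpl in HL; lia].
  - destruct (classic (In [] l)) as [H0|H0]; [now apply base|].
    rewrite measure_tails by assumption.
    assert (H : forall b, measure (tails b l) <= 1).
    { intros b. apply IH; [|now apply prefix_free_tails].
      intros s Hs%in_tails. apply HL in Hs. simpl in Hs. lia. }
    pose proof (H false). pose proof (H true). lra.
Qed.

(** Choose for each [s] a program [p] with [length p + 1 <= length s]. Distinct strings get distinct
    programs, so Kraft's inequality bounds the measure of the programs by 1, and that of [l] by half
    as much. *)
Lemma measure_compressible V l :
  prefix_free_domain V -> NoDup l -> (forall s, In s l -> H_lt_length V s) ->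
  measure l <= / 2.
Proof.
  intros HV Hl Hc.
  assert (H : exists ps, NoDup ps /\
    (forall p, In p ps -> exists s, In s l /\ V p = Some s) /\ measure l <= measure ps / 2).
  { induction Hl as [|s l Hs Hl IH].
    - exists []. repeat split; [constructor | intros p [] | simpl; lra].
    - destruct IH as (ps & H1 & H2 & H3); [intros; apply Hc; now right|].
      destruct (Hc s (or_introl eq_refl)) as (p & Hp & Hlt).
      exists (p :: ps). split; [|split].
      + constructor; [|assumption]. intros [t [Ht Ht']]%H2. congruence.
      + intros q [<-|[t [Ht Ht']]%H2]; [exists s | exists t]; simpl; auto.
      + cbn [measure]. assert (/ 2 ^ length s <= / 2 ^ S (length p)).
        { apply Rinv_le_contravar; [apply pow_lt; lra|]. apply Rle_pow; [lra | lia]. }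
        rewrite inv_pow2_S in H. lra. }
  destruct H as (ps & H1 & H2 & H3).
  assert (measure ps <= 1); [|lra].
  apply kraft. split; [assumption|].
  intros p q (s & _ & Hs)%H2 (t & _ & Ht)%H2. apply HV; congruence.
Qed.

(** * Incompressible strings of every length *)

Fixpoint strings (n : nat) : list bstring :=
  match n with
  | O => [[]]
  | S n => map (cons false) (strings n) ++ map (cons true) (strings n)
  end.

Lemma in_strings n s : In s (strings n) -> length s = n.
Proof.
  revert s. induction n as [|n IH]; simpl; intros s H.
  - destruct H as [<-|[]]. reflexivity.
  - apply in_app_or in H as [H|H]; apply in_map_iff in H as [t [<- Ht%IH]]; simpl; auto.
Qed.

Lemma NoDup_strings n : NoDup (strings n).
Proof.
  induction n as [|n IH]; simpl.
  - constructor; [intros [] | constructor].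
  - apply NoDup_app; try (apply Injective_map_NoDup; [congruence | assumption]).
    intros s [t [<- _]]%in_map_iff [u [[=] _]]%in_map_iff.
Qed.

Lemma measure_app l l' : measure (l ++ l') = measure l + measure l'.
Proof. induction l as [|s l IH]; simpl; lra. Qed.

Lemma measure_map_cons b l : measure (map (cons b) l) = measure l / 2.
Proof.
  induction l as [|s l IH]; cbn [map measure length]; [|rewrite inv_pow2_S]; lra.
Qed.

Lemma measure_strings n : measure (strings n) = 1.
Proof.
  induction n as [|n IH]; simpl; [|rewrite measure_app, !measure_map_cons]; lra.
Qed.

(** All strings of length [n] together have measure 1, while compressible ones account for at most
    1/2. *)
Lemma incompressible_exists V n :
  prefix_free_domain V -> exists s, length s = n /\ ~ H_lt_length V s.
Proof.
  intros HV. apply NNPP. intros H.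
  assert (measure (strings n) <= / 2); [|rewrite measure_strings in *; lra].
  apply (measure_compressible V); [assumption | apply NoDup_strings|].
  intros s Hs%in_strings. apply NNPP. eauto.
Qed.

(** * The real number Theta *)

Lemma Theta_term_nonneg V k : 0 <= Theta_term V k.
Proof.
  unfold Theta_term. destruct excluded_middle_informative; [|lra].
  left. apply inv_pow2_pos.
Qed.

Lemma Theta_sum_le V n : prefix_free_domain V -> sum_f_R0 (Theta_term V) n <= / 2.
Proof.
  intros HV.
  assert (H : exists l, NoDup l /\ (forall s, In s l -> H_lt_length V s) /\
    (forall s, In s l -> (code_str s <= n)%nat) /\ sum_f_R0 (Theta_term V) n = measure l).
  (* The bound on the codes ensures that the string number [k] is new to the list. *)
  { assert (step : forall k a l, NoDup l -> (forall s, In s l -> H_lt_length V s) ->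
      (forall s, In s l -> (code_str s < k)%nat) -> a = measure l ->
      exists l', NoDup l' /\ (forall s, In s l' -> H_lt_length V s) /\
        (forall s, In s l' -> (code_str s <= k)%nat) /\ a + Theta_term V k = measure l').
    { intros k a l H1 H2 H3 ->. unfold Theta_term.
      destruct excluded_middle_informative as [Hk|Hk].
      - exists (decode_str k :: l). repeat split.
        + constructor; [|assumption]. intros Hin%H3. rewrite code_decode in Hin. lia.
        + intros s [<-|Hs]; auto.
        + intros s [<-|Hs%H3]; [rewrite code_decode|]; lia.
        + cbn [measure]. lra.
      - exists l. repeat split; auto; [|lra]. intros s Hs%H3. lia. }
    induction n as [|n (l & H1 & H2 & H3 & H4)].
    - destruct (step 0%nat 0 []) as (l & H1 & H2 & H3 & H4);
        try (intros s []); [constructor | reflexivity|].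
      exists l. repeat split; auto. simpl. lra.
    - apply (step (S n) _ l); auto. intros s Hs%H3. lia. }
  destruct H as (l & H1 & H2 & _ & ->). now apply (measure_compressible V).
Qed.

Lemma Theta_converges V :
  prefix_free_domain V -> exists theta, infinite_sum (Theta_term V) theta.
Proof.
  intros HV. destruct (growing_cv (sum_f_R0 (Theta_term V))) as [theta H].
  - intros n. simpl. pose proof (Theta_term_nonneg V (S n)). lra.
  - exists (/ 2). intros x [n ->]. now apply Theta_sum_le.
  - exists theta. exact H.
Qed.

Lemma sum_le_infinite_sum f l n :
  (forall k, 0 <= f k) -> infinite_sum f l -> sum_f_R0 f n <= l.
Proof.
  intros Hf Hl. apply (growing_ineq (sum_f_R0 f)); [|exact Hl].
  intros k. simpl. specialize (Hf (S k)). lra.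
Qed.

(** With this range theta is its own fractional part, so its bits can be read off directly. *)
Lemma Theta_range V theta :
  prefix_free_domain V -> infinite_sum (Theta_term V) theta -> 0 <= theta < 1.
Proof.
  intros HV H. split.
  - pose proof (sum_le_infinite_sum _ _ 0 (Theta_term_nonneg V) H).
    pose proof (Theta_term_nonneg V 0). simpl in *. lra.
  - apply Rnot_le_lt. intros H1. destruct (H (/ 2)) as [N HN]; [lra|].
    specialize (HN N (le_n N)). pose proof (Theta_sum_le V N HV).
    unfold Rdist in HN. apply Rabs_def2 in HN. lra.
Qed.

(** * Stage sums and their convergence to theta *)

Definition stage_term (E : nat -> nat -> bool) (m k : nat) : R :=
  if E m k then / 2 ^ len k else 0.

Definition stage_value (E : nat -> nat -> bool) (m : nat) : R :=
  INR (stage_numerator E m) / 2 ^ m.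

Lemma stage_term_le V E m k : enumerates V E -> stage_term E m k <= Theta_term V k.
Proof.
  intros (_ & _ & _ & HE). unfold stage_term, Theta_term.
  destruct (E m k) eqn:Ek; destruct excluded_middle_informative as [H|H].
  - rewrite length_decode_str. lra.
  - elim H. apply HE. eauto.
  - left. apply inv_pow2_pos.
  - lra.
Qed.

Lemma INR_pow2 n : INR (2 ^ n) = 2 ^ n.
Proof. rewrite pow_INR. reflexivity. Qed.

(** Stage [m] finds only strings with numbers below [m], so the later terms vanish. The freedom in
    [n] allows comparison with long partial sums of theta. *)
Lemma stage_value_sum V E m n :
  enumerates V E -> (m <= S n)%nat -> stage_value E m = sum_f_R0 (stage_term E m) n.
Proof.
  intros (_ & _ & Hlt & _) Hmn. unfold stage_value, stage_numerator.
  set (f := fun k => (if E m k then 2 ^ (m - len k) else 0)%nat).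
  assert (H0 : 2 ^ m <> 0) by (apply pow_nonzero; lra).
  assert (Hf : forall k, INR (f k) = 2 ^ m * stage_term E m k).
  { intros k. unfold f, stage_term. destruct (E m k) eqn:Ek; [|simpl; lra].
    apply Hlt in Ek. pose proof (len_le k). rewrite INR_pow2.
    replace m with ((m - len k) + len k)%nat at 2 by lia.
    rewrite pow_add. field. apply pow_nonzero. lra. }
  assert (Hext : forall j, (m <= j)%nat -> sum_below m f = sum_below j f).
  { induction 1 as [|j Hj IH]; [reflexivity|]. simpl. rewrite IH.
    unfold f at 3. destruct (E m j) eqn:Ek; [apply Hlt in Ek|]; lia. }
  rewrite (Hext _ Hmn). clear Hmn Hext.
  apply (Rmult_eq_reg_l (2 ^ m)); [|assumption].
  transitivity (INR (sum_below (S n) f)); [field; assumption|].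
  induction n as [|n IH].
  - simpl. apply Hf.
  - change (sum_below (S (S n)) f) with (sum_below (S n) f + f (S n))%nat.
    rewrite plus_INR, IH, Hf. simpl. ring.
Qed.

Lemma stage_value_le V E theta m :
  enumerates V E -> infinite_sum (Theta_term V) theta -> stage_value E m <= theta.
Proof.
  intros HE H. rewrite (stage_value_sum V E m m HE) by lia.
  apply Rle_trans with (sum_f_R0 (Theta_term V) m).
  - apply sum_Rle. intros k _. now apply stage_term_le.
  - apply sum_le_infinite_sum; [apply Theta_term_nonneg | assumption].
Qed.

(** A compressible string not yet found still has its whole weight to contribute. This is what
    forces all compressible strings of a given length to appear once the stage sum is close to
    theta. *)
Lemma stage_value_missing V E theta m k :
  enumerates V E -> infinite_sum (Theta_term V) theta ->
  H_lt_length V (decode_str k) -> E m k = false ->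
  stage_value E m + / 2 ^ len k <= theta.
Proof.
  intros HE H Hk Ek. set (n := Nat.max m k).
  apply Rle_trans with (sum_f_R0 (Theta_term V) n);
    [|apply sum_le_infinite_sum; [apply Theta_term_nonneg | assumption]].
  rewrite (stage_value_sum V E m n HE) by lia.
  assert (Hn : (k <= n)%nat) by lia. clearbody n.
  assert (Hle : forall j, sum_f_R0 (stage_term E m) j <= sum_f_R0 (Theta_term V) j)
    by (intros j; apply sum_Rle; intros i _; now apply stage_term_le).
  assert (Hterm : stage_term E m k + / 2 ^ len k <= Theta_term V k).
  { unfold stage_term, Theta_term. rewrite Ek, length_decode_str.
    destruct excluded_middle_informative; [lra | contradiction]. }
  (* Past the index [k] each stage term is at most the corresponding term of theta, so the gap
     opened at [k] persists. *)
  induction Hn as [|n Hn IH].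
  - destruct k as [|k]; simpl; [assumption|]. specialize (Hle k). lra.
  - simpl. pose proof (stage_term_le V E m (S n) HE). lra.
Qed.

(** Some partial sum of theta is within [eps] of it. Its finitely many terms are all present from a
    common stage on, and from then on the stage sum lies between this partial sum and theta. *)
Lemma stage_value_cv V E theta :
  enumerates V E -> infinite_sum (Theta_term V) theta -> Un_cv (stage_value E) theta.
Proof.
  intros HE H eps Heps. destruct (H eps Heps) as [N HN].
  specialize (HN N (le_n N)). unfold Rdist in HN. apply Rabs_def2 in HN.
  assert (Hk : forall k, exists M, forall m, (M <= m)%nat ->
    Theta_term V k <= stage_term E m k).
  { intros k. destruct HE as (_ & mono & _ & HE).
    unfold Theta_term, stage_term. rewrite length_decode_str.
    destruct excluded_middle_informative as [Hk|Hk].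
    - apply HE in Hk as [M HM]. exists M. intros m Hm. rewrite (mono M m k Hm HM). lra.
    - exists 0%nat. intros m _. destruct (E m k); [left; apply inv_pow2_pos | lra]. }
  assert (HM : exists M, forall m k, (M <= m)%nat -> (k <= N)%nat ->
    Theta_term V k <= stage_term E m k).
  { clear HN. induction N as [|N [M HM]].
    - destruct (Hk 0%nat) as [M HM]. exists M. intros m k Hm Hk0.
      replace k with 0%nat by lia. auto.
    - destruct (Hk (S N)) as [M' HM']. exists (Nat.max M M'). intros m k Hm Hkn.
      destruct (Nat.eq_dec k (S N)) as [->|Hne]; [apply HM' | apply HM]; lia. }
  destruct HM as [M HM]. exists (Nat.max M (S N)). intros m Hm.
  assert (sum_f_R0 (Theta_term V) N <= stage_value E m).
  { rewrite (stage_value_sum V E m m HE) by lia.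
    apply Rle_trans with (sum_f_R0 (stage_term E m) N).
    - apply sum_Rle. intros k Hkn. apply HM; lia.
    - assert (Hj : forall j, (N <= j)%nat ->
        sum_f_R0 (stage_term E m) N <= sum_f_R0 (stage_term E m) j); [|apply Hj; lia].
      induction 1 as [|j Hj IH]; [lra|]. simpl.
      assert (0 <= stage_term E m (S j)); [|lra].
      unfold stage_term. destruct (E m (S j)); [left; apply inv_pow2_pos | lra]. }
  pose proof (stage_value_le V E theta m HE H).
  unfold Rdist. apply Rabs_def1; lra.
Qed.

(** * Left-computability of theta *)

Definition negated_stage (E : nat -> nat -> bool) (m : nat) : Q :=
  Qmake (- Z.of_nat (stage_numerator E m)) (Pos.of_nat (2 ^ m)).

Lemma Q2R_negated_stage E m : Q2R (negated_stage E m) = - stage_value E m.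
Proof.
  unfold Q2R, negated_stage, stage_value. simpl Qnum. simpl Qden.
  rewrite opp_IZR, <- INR_IZR_INZ, <- positive_nat_Z, <- INR_IZR_INZ, Nat2Pos.id, INR_pow2
    by now apply Nat.pow_nonzero.
  field. apply pow_nonzero. lra.
Qed.

(** The fraction is left unreduced, which makes its code an explicit formula. Truncated subtraction
    also covers the numerator 0, whose code is 0. *)
Lemma code_negated_stage E m :
  code_Q (negated_stage E m) = cpair (2 * stage_numerator E m - 1) (2 ^ m - 1).
Proof.
  unfold code_Q, negated_stage. simpl Qnum. simpl Qden.
  rewrite Nat2Pos.id by now apply Nat.pow_nonzero. f_equal. unfold code_Z.
  destruct (Z.leb_spec 0 (- Z.of_nat (stage_numerator E m))); lia.
Qed.

Lemma negated_stage_computable V E : enumerates V E -> computable_Qseq (negated_stage E).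
Proof.
  intros HE.
  assert (H : computable 1 (fun v => code_Q (negated_stage E (hd 0%nat v)))).
  { eapply computable_ext; [intros v _; symmetry; apply code_negated_stage|].
    assert (Ha : computable 1 (fun v => 2 * stage_numerator E (hd 0 v) - 1)%nat).
    { apply computable_sub; [apply computable_mul|]; try apply computable_const.
      apply (computable_stage_numerator V); [assumption | computable_variable]. }
    assert (Hb : computable 1 (fun v => 2 ^ hd 0 v - 1)%nat).
    { apply computable_sub; [apply computable_pow2; computable_variable|].
      apply computable_const. }
    apply computable_add; [|assumption].
    apply computable_div; [|apply computable_const|discriminate].
    apply computable_mul; [|apply computable_add; [|apply computable_const]];
      apply computable_add; assumption. }
  destruct H as [e He]. exists e. intros n. now apply (He [n]).
Qed.

Lemma Theta_left_computable V theta :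
  partial_recursive V -> infinite_sum (Theta_term V) theta -> left_computable theta.
Proof.
  intros [E HE]%enumerates_exists H. exists (negated_stage E). split; [|split].
  - now apply (negated_stage_computable V).
  - intros m _. rewrite Q2R_negated_stage. pose proof (stage_value_le V E theta m HE H). lra.
  - intros eps Heps. destruct (stage_value_cv V E theta HE H eps Heps) as [N HN].
    exists N. intros n Hn. rewrite Q2R_negated_stage. specialize (HN (S n) ltac:(lia)).
    unfold Rdist in *.
    replace (- stage_value E (S n) - - theta) with (- (stage_value E (S n) - theta)) by ring.
    now rewrite Rabs_Ropp.
Qed.

(** * Binary expansions and weak Chaitin randomness *)

Lemma length_restr a n : length (restr a n) = n.
Proof. unfold restr. now rewrite length_map, length_seq. Qed.

Lemma frac_part_id a : 0 <= a < 1 -> frac_part a = a.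
Proof.
  intros Ha. unfold frac_part. destruct (base_Int_part a) as [H1 H2].
  assert (Int_part a < 1)%Z by (apply lt_IZR; lra).
  assert (-1 < Int_part a)%Z by (apply lt_IZR; lra).
  replace (Int_part a) with 0%Z by lia. lra.
Qed.

(** The first [n] bits spell the integer part of [a * 2 ^ n]. *)
Lemma restr_approximates a n :
  0 <= a < 1 -> INR (binary_value (restr a n)) <= a * 2 ^ n < INR (binary_value (restr a n)) + 1.
Proof.
  intros Ha. induction n as [|n IH]; [simpl; lra|].
  unfold restr in *. rewrite seq_S, map_app. cbn [map].
  rewrite binary_value_snoc, plus_INR, mult_INR.
  set (x := binary_value (map (bit a) (seq 1 n))) in *.
  change (1 + n)%nat with (S n). unfold bit. rewrite frac_part_id by assumption.
  simpl pow in *. destruct (base_Int_part (a * (2 * 2 ^ n))) as [H1 H2].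
  set (w := Int_part (a * (2 * 2 ^ n))) in *.
  rewrite (INR_IZR_INZ x) in IH |- *.
  (* Doubling leaves two candidates for the next integer part, and its parity, which is the new bit,
     selects one. *)
  assert (2 * Z.of_nat x <= w < 2 * Z.of_nat x + 2)%Z as Hw.
  { split; [apply Zlt_succ_le|]; apply lt_IZR; unfold Z.succ;
      rewrite ?plus_IZR, ?mult_IZR; lra. }
  assert (Ew : IZR w = 2 * IZR (Z.of_nat x) + INR (Nat.b2n (Z.odd w))).
  { assert (w = 2 * Z.of_nat x \/ w = 2 * Z.of_nat x + 1)%Z as [E|E] by lia; rewrite E.
    - rewrite Z.odd_mul, mult_IZR. simpl. lra.
    - rewrite Z.add_comm, Z.odd_add_mul_2, plus_IZR, mult_IZR. simpl. lra. }
  change (INR 2) with 2. lra.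
Qed.

Lemma Theta_weakly_chaitin_random U V theta :
  prefix_free_machine U -> optimal V -> infinite_sum (Theta_term V) theta ->
  weakly_chaitin_random U theta.
Proof.
  intros [[eU HU] HUp] [[HVr HVp] HVo] H.
  destruct (enumerates_exists V HVr) as [E HE].
  destruct (incompressible_search V E HE) as [e He].
  destruct (machine_of_mu (MComp e [eU])) as [C HC].
  destruct (HVo C) as [d Hd].
  { split; [now exists (MComp e [eU])|].
    (* [C] runs the search on the output of [U], so its domain lies in that of [U] and inherits
       prefix-freeness. *)
    assert (dom : forall p, C p <> None -> U p <> None).
    { intros p Hp Hn. destruct (C p) as [s|] eqn:Es; [|now apply Hp].
      apply HC in Es. inversion Es as [| | |? ? ? ys ? H1 _| | |]; subst.
      inversion H1 as [|? ? ? y ? H2 _]; subst.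
      rewrite <- (code_decode y) in H2. apply HU in H2. congruence. }
    intros p q Hp Hq. apply HUp; auto. }
  pose proof (Theta_range V theta HVp H) as Hrange.
  (* [d] is the cost of simulating [C] by [V]; 1 is lost because the string found has length
     [n - 1]. *)
  exists (d + 1)%nat. intros n Hn p Hp.
  set (s := restr theta n) in *.
  assert (Hs : coded_value (code_str s) = binary_value s /\ len (code_str s) = n).
  { split; [apply coded_value_code_str|]. rewrite len_code_str. apply length_restr. }
  destruct Hs as [Hs1 Hs2].
  destruct (restr_approximates theta n Hrange) as [Hle Hlt]. fold s in Hle, Hlt.
  assert (Hpow : forall k, 0 < 2 ^ k) by (intros; apply pow_lt; lra).
  (* This translates the search condition on natural numbers into one on the real stage sums. *)
  assert (Hcmp : forall m, (coded_value (code_str s) * 2 ^ m <=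
      stage_numerator E m * 2 ^ len (code_str s) + 2 ^ m)%nat <->
    INR (binary_value s) <= stage_value E m * 2 ^ n + 1).
  { intros m. rewrite Hs1, Hs2.
    assert (Em : stage_value E m * 2 ^ m = INR (stage_numerator E m))
      by (unfold stage_value; field; apply Rgt_not_eq, Hpow).
    specialize (Hpow m). split.
    - intros Hm%le_INR. rewrite plus_INR, !mult_INR, !INR_pow2, <- Em in Hm. nra.
    - intros Hm. apply INR_le. rewrite plus_INR, !mult_INR, !INR_pow2, <- Em. nra. }
  (* A stage sum within [/ 2 ^ n] of theta satisfies the search condition, since the value of the
     bits is at most [theta * 2 ^ n]. *)
  destruct (stage_value_cv V E theta HE H (/ 2 ^ n) (inv_pow2_pos n)) as [m0 Hm0].
  specialize (Hm0 m0 (le_n m0)). unfold Rdist in Hm0. apply Rabs_def2 in Hm0.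
  assert (Hinv : 2 ^ n * / 2 ^ n = 1) by (apply Rinv_r, Rgt_not_eq, Hpow).
  destruct (He (code_str s) m0) as (m & k & Hk1 & Hk2 & Hk3 & Hk4).
  { apply Hcmp. specialize (Hpow n). nra. }
  { intros m. destruct (incompressible_exists V (n - 1) HVp) as (t & Ht1 & Ht2).
    exists (code_str t). rewrite len_code_str, Hs2. split; [lia|].
    apply Bool.not_true_is_false. intros Et. apply Ht2.
    rewrite <- (decode_code t). destruct HE as (_ & _ & _ & HE). apply HE. eauto. }
  destruct (Hd p (decode_str k)) as (q & Hq1 & Hq2).
  { apply HC. rewrite code_decode. econstructor; [|exact Hk1].
    repeat constructor. now apply HU. }
  rewrite Hs2 in Hk3.
  (* Otherwise the missing weight, which is [2 / 2 ^ n], would put theta at or above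
     [(binary_value s + 1) / 2 ^ n], against [Hlt]. *)
  assert (Hk : ~ H_lt_length V (decode_str k)).
  { intros Hk. pose proof (stage_value_missing V E theta m k HE H Hk Hk4) as Hmiss.
    apply Hcmp in Hk2. rewrite <- Hk3 in *.
    assert (2 ^ S (len k) * / 2 ^ len k = 2)
      by (simpl; field; apply Rgt_not_eq, Hpow).
    specialize (Hpow (S (len k))). nra. }
  assert (~ (length q < len k)%nat); [|lia].
  intros Hql. apply Hk. exists q. now rewrite length_decode_str.
Qed.

Theorem theorem6 : forall U V : machine, optimal U -> optimal V ->
  exists theta : R,
    infinite_sum (Theta_term V) theta /\
    left_computable theta /\
    weakly_chaitin_random U theta.
Proof.
  intros U V [HU _] HV. destruct (proj1 HV) as [HVr HVp].
  destruct (Theta_converges V HVp) as [theta H].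
  exists theta. split; [assumption|]. split.
  - now apply (Theta_left_computable V).
  - now apply (Theta_weakly_chaitin_random U V).
Qed.
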